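(* For every even positive integer $p$, $$\sum_{n=2}^{\infty}\frac{\left[\sum_{k=1}^{p/2}L_{(2k-1)p^n/2}\right]^2-1}{L_{p^{n+1}}-2} = \frac{1}{L_{p^2}-2}.$$
   Context: $L_n$ denotes the $n$-th Lucas number: $L_n=\alpha^n+\beta^n$, where $\alpha=\frac{1+\sqrt5}{2}$ and $\beta=\frac{1-\sqrt5}{2}$ (so $L_0=2$, $L_1=1$). The index $(2k-1)p^n/2$ means the integer $\frac{(2k-1)p^n}{2}$. *)

(* Defs.v *)
(* MathComp / MathComp-Analysis *)
From mathcomp Require Import all_boot all_order all_algebra.
From mathcomp Require Import all_classical all_reals all_analysis.

Set Implicit Arguments.
Unset Strict Implicit.
Unset Printing Implicit Defensive.

Import Order.TTheory GRing.Theory Num.Theory.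
Import numFieldNormedType.Exports.

Local Open Scope ring_scope.

Definition golden_alpha (R : realType) : R := (1 + Num.sqrt 5) / 2.

Definition golden_beta (R : realType) : R := (1 - Num.sqrt 5) / 2.

Definition lucas (R : realType) (n : nat) : R :=
  golden_alpha R ^+ n + golden_beta R ^+ n.

(* The truncated operations on the index are exact where this is used: k starts
   at 1, and p is even with n >= 2, so (2k-1)p^n is even. *)
Definition lucas_term (R : realType) (p n : nat) : R :=
  ((\sum_(1 <= k < (p %/ 2).+1) lucas R (((2 * k - 1) * p ^ n) %/ 2)) ^+ 2 - 1)
  / (lucas R (p ^ n.+1) - 2).

(* Main.v *)
(* Put x = alpha^(p^n/2) and y = beta^(p^n/2).  Since n >= 2, the exponent is
   even, so xy = 1 and L_(p^n) - 2 = (x - y)^2.  Multiplying the inner sum by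
   x - y telescopes it to x^p - y^p, so its square is the quotient of
   L_(p^(n+1)) - 2 by L_(p^n) - 2.  The summand is therefore
   1/(L_(p^n) - 2) - 1/(L_(p^(n+1)) - 2), and the outer series telescopes. *)
Require Import Defs.
From mathcomp Require Import all_boot all_order all_algebra.
From mathcomp Require Import all_classical all_reals all_analysis.
From mathcomp Require Import ring lra zify.
Import Order.TTheory GRing.Theory Num.Theory.
Import numFieldNormedType.Exports.
Local Open Scope classical_set_scope.
Local Open Scope ring_scope.

(** Since xy = 1, (x - y)(x^m + y^m) is the difference of x^(m+1) - y^(m+1) and x^(m-1) - y^(m-1),
    so summing over odd m telescopes. *)
Lemma sum_odd_powers (K : comPzRingType) (x y : K) (r : nat) : x * y = 1 ->
  (x - y) * \sum_(1 <= k < r.+1) (x ^+ (2 * k - 1) + y ^+ (2 * k - 1))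
  = x ^+ (2 * r) - y ^+ (2 * r).
Proof.
move=> xy1; elim: r => [|r IHr]; first by rewrite big_geq // mulr0 !expr0 subrr.
rewrite big_nat_recr //= mulrDr IHr.
have -> : (2 * r.+1 - 1 = (2 * r).+1)%N by lia.
have -> : (2 * r.+1 = (2 * r).+2)%N by lia.
rewrite !exprS; set X := x ^+ _; set Y := y ^+ _.
have -> : (x - y) * (x * X + y * Y)
  = x * (x * X) - y * (y * Y) + (x * y) * (Y - X) by ring.
by rewrite xy1 mul1r; ring.
Qed.

Lemma golden_alphaMbeta (R : realType) : golden_alpha R * golden_beta R = -1.
Proof.
have s5 : Num.sqrt 5 ^+ 2 = 5 :> R by rewrite sqr_sqrtr.
rewrite /golden_alpha /golden_beta.
have -> : (1 + Num.sqrt 5) / 2 * ((1 - Num.sqrt 5) / 2)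
  = (1 - Num.sqrt 5 ^+ 2) / 4 :> R by field.
by rewrite s5; field.
Qed.

Lemma golden_alpha_ge (R : realType) : 3 / 2 <= golden_alpha R.
Proof.
have : (2 : R) <= Num.sqrt 5.
  by rewrite -(@ler_pXn2r _ 2) ?nnegrE ?sqrtr_ge0 // sqr_sqrtr //; lra.
rewrite /golden_alpha; lra.
Qed.

Lemma golden_pow_mul (R : realType) (h : nat) : ~~ odd h ->
  golden_alpha R ^+ h * golden_beta R ^+ h = 1.
Proof. by move=> h_even; rewrite -exprMn golden_alphaMbeta -signr_odd (negbTE h_even). Qed.

Lemma lucas_double_sub2 (R : realType) (h : nat) : ~~ odd h ->
  lucas R (2 * h) - 2 = (golden_alpha R ^+ h - golden_beta R ^+ h) ^+ 2.
Proof.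
move=> /(golden_pow_mul R) xy1.
by rewrite sqrrB xy1 /lucas mulnC !exprM; ring.
Qed.

(** Bernoulli's inequality for alpha >= 1 + 1/2, together with beta^m >= 0 for even m. This crude
    linear bound gives both the positivity of the denominators and their divergence. *)
Lemma lucas_sub2_ge (R : realType) (m : nat) : ~~ odd m ->
  m%:R / 2 - 1 <= lucas R m - 2.
Proof.
move=> m_even; have aP := golden_alpha_ge R.
have alpha_pow (n : nat) : 1 + n%:R / 2 <= golden_alpha R ^+ n.
  elim: n => [|n IHn]; first by rewrite expr0; lra.
  rewrite exprS -natr1; have := ler0n R n; nra.
have b_ge0 : 0 <= golden_beta R ^+ m by rewrite exprn_even_ge0.
have := alpha_pow m; rewrite /lucas; lra.
Qed.

Lemma half_pow (p n : nat) : ~~ odd p -> (1 < n)%N ->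
  exists2 h, ~~ odd h & (p ^ n = 2 * h)%N.
Proof.
move=> p_even; case: n => [|[|n]] // _.
(* Only one factor [p] is halved; as the original exponent is at least 2, another even factor [p]
   remains. *)
exists (p./2 * p ^ n.+1)%N; first by rewrite oddM oddX (negbTE p_even) andbF.
by rewrite mulnA mul2n even_halfK // -expnS.
Qed.

Lemma lucas_pow_sub2_gt0 (R : realType) (p n : nat) : (0 < p)%N -> ~~ odd p ->
  (1 < n)%N -> 0 < lucas R (p ^ n) - 2.
Proof.
move=> p_gt0 p_even n_gt1.
have pn_gt2 : (2 < p ^ n)%N.
  have : (2 ^ 2 <= p ^ 2)%N by rewrite leq_exp2r //; case: p p_gt0 p_even => [|[]].
  by have : (p ^ 2 <= p ^ n)%N by [rewrite leq_pexp2l]; lia.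
have pn_even : ~~ odd (p ^ n) by rewrite oddX (negbTE p_even) orbF -lt0n ltnW.
apply: lt_le_trans _ (lucas_sub2_ge R _ pn_even).
by have : 2 < (p ^ n)%:R :> R by [rewrite ltr_nat]; lra.
Qed.

Lemma lucas_term_telescope (R : realType) (p n : nat) : (0 < p)%N -> ~~ odd p ->
  (1 < n)%N ->
  lucas_term R p n = (lucas R (p ^ n) - 2)^-1 - (lucas R (p ^ n.+1) - 2)^-1.
Proof.
move=> p_gt0 p_even n_gt1.
have [h h_even pnE] := half_pow _ _ p_even n_gt1.
have := lucas_pow_sub2_gt0 R _ _ p_gt0 p_even n_gt1.
have := lucas_pow_sub2_gt0 R _ _ p_gt0 p_even (leqW n_gt1).
have -> : (p ^ n.+1 = 2 * (h * p))%N by rewrite expnSr pnE mulnA.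
rewrite /lucas_term expnSr pnE -mulnA.
rewrite !lucas_double_sub2 ?oddM ?(negbTE h_even) // !exprM.
set x := golden_alpha R ^+ h; set y := golden_beta R ^+ h.
have p2E : (p = 2 * (p %/ 2))%N by rewrite divn2 mul2n even_halfK.
(* The halved index is exactly h(2k-1), so the inner sum runs over odd powers of [x] and [y]. *)
under eq_bigr => k _.
  have -> : ((2 * k - 1) * (2 * h) %/ 2 = h * (2 * k - 1))%N.
    by rewrite mulnCA mulKn // mulnC.
  rewrite /lucas !exprM -/x -/y; over.
have := sum_odd_powers _ _ _ (p %/ 2) (golden_pow_mul R _ h_even).
rewrite -p2E -/x -/y; set S := \sum_(1 <= k < _) _ => SE.
(* The two denominators are now (x - y)^2 S^2 and (x - y)^2; their positivity makes both factors
   nonzero. *)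
rewrite -SE !exprMn => xyS_gt0 xy_gt0.
have xy_neq0 : x - y != 0 by rewrite -sqrf_eq0 gt_eqF.
have S_neq0 : S != 0.
  by apply: contraTneq xyS_gt0 => ->; rewrite expr0n mulr0 ltxx.
by field; rewrite xy_neq0 S_neq0.
Qed.

Lemma inv_lucas_pow_sub2_cvg0 (R : realType) (p : nat) : (0 < p)%N -> ~~ odd p ->
  (lucas R (p ^ n) - 2)^-1 @[n --> \oo] --> (0 : R).
Proof.
move=> p_gt0 p_even; apply/gtr0_cvgV0.
  by near=> n; apply: lucas_pow_sub2_gt0 => //; near: n; exact: nbhs_infty_gt.
apply/cvgryPge => A; near=> n.
have n_gt0 : (0 < n)%N by near: n; exact: nbhs_infty_gt.
have pn_even : ~~ odd (p ^ n) by rewrite oddX (negbTE p_even) orbF -lt0n.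
apply: le_trans _ (lucas_sub2_ge R _ pn_even).
have n_le : n%:R <= (p ^ n)%:R :> R.
  by rewrite ler_nat ltnW // ltn_expl //; case: p p_gt0 p_even {pn_even} => [|[]].
(* This threshold is the one at which n/2 - 1 reaches [A]. *)
have : 2 * (A + 1) <= n%:R by near: n; exact: nbhs_infty_ger.
lra.
Unshelve. all: by end_near. Qed.

Theorem theorem9 (R : realType) (p : nat) (p_gt0 : (0 < p)%N)
    (p_even : ~~ odd p) :
  \sum_(2 <= n < N) lucas_term R p n @[N --> \oo]
    --> 1 / (lucas R (p ^ 2) - 2).
Proof.
set u := fun n : nat => (lucas R (p ^ n) - 2)^-1.
(* For N < 2 the sum is empty, so the closed form is claimed only eventually. *)
have partial_sum : \forall N \near \oo,
    u 2%N - u N = \sum_(2 <= n < N) lucas_term R p n.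
  near=> N; have N_ge2 : (2 <= N)%N by near: N; exact: nbhs_infty_ge.
  (* Telescoping is stated for differences f(n+1) - f(n), hence the sign on [u]. *)
  rewrite (@GRing.telescope_sumr_eq _ _ _ (fun n => - u n)) //.
    by rewrite opprK addrC.
  by move=> n /andP[n_ge2 _]; rewrite lucas_term_telescope // opprK addrC.
apply: cvg_trans (near_eq_cvg partial_sum) _.
rewrite div1r -[_^-1]subr0.
by apply: cvgB; [exact: cvg_cst | exact: inv_lucas_pow_sub2_cvg0].
Unshelve. all: by end_near. Qed.
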